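(* Let $G$ be a regular graph with adjacency matrix $A$, and let $\Gamma$ be a finite abelian group with invariant factor decomposition $$\Gamma\cong \mathbb Z/d_1\mathbb Z\oplus\cdots\oplus\mathbb Z/d_r\mathbb Z,\qquad d_1\mid\cdots\mid d_r .$$ Put $B_\Gamma=\bigoplus_{i=1}^{r-1}\mathbb Z/d_i\mathbb Z$, where $B_\Gamma=\{0\}$ when $r=1$. Then $d_r=\exp(\Gamma)$, and the following statements hold. (a) $G$ admits a generating $\Gamma$-magic map if and only if $B_\Gamma\hookrightarrow\ker\overline A_{d_r}$. (b) $G$ admits an affinely generating $\Gamma$-magic map if and only if $\Gamma\hookrightarrow\ker\overline A_{d_r}$. (c) If $|V(G)|=|\Gamma|$, then $G$ admits a $\Gamma$-distance magic labeling if and only if $\Gamma\hookrightarrow\ker\overline A_{d_r}$ with vertex-separating image (i.e. there is an injective homomorphism $\Gamma\to\ker\overline A_{d_r}$ whose image is a vertex-separating subgroup).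
   Context: Graphs are finite, simple, undirected, with nonempty vertex set; abelian groups are written additively. $N_G(v)$ is the (open) neighborhood of $v$. In an invariant factor decomposition $r\ge1$ and all $d_i>1$, except that the trivial group has $r=1$, $d_1=1$. $\exp(H)$ is the exponent of a finite abelian group $H$. $H\hookrightarrow K$ means that there exists an injective group homomorphism $H\to K$. A map $f\colon V(G)\to\Gamma$ is a $\Gamma$-magic map if there is $\gamma\in\Gamma$ with $\sum_{u\in N_G(v)}f(u)=\gamma$ for every $v\in V(G)$. It is generating if $\langle f(v)\mid v\in V(G)\rangle=\Gamma$, and affinely generating if $D(f):=\langle f(v)-f(w)\mid v,w\in V(G)\rangle=\Gamma$. A $\Gamma$-distance magic labeling is a bijective $\Gamma$-magic map (so $|V(G)|=|\Gamma|$). If $G$ is $k$-regular with adjacency matrix $A$ and $m\ge1$, let $A_m$ be the endomorphism of $(\mathbb Z/m\mathbb Z)^{V(G)}$ given by $A$ modulo $m$. Since $A_m\mathbf 1=k\mathbf 1$ ($\mathbf 1$ the all-one vector), $A_m$ induces an endomorphism $\overline A_m([x])=[A_mx]$ of the quotient $(\mathbb Z/m\mathbb Z)^{V(G)}/(\mathbb Z/m\mathbb Z)\mathbf 1$. A subgroup $W\le\ker\overline A_m$ is vertex-separating if for every pair of distinct vertices $v,w$ some class $[x]\in W$ satisfies $x_v-x_w\neq0$ in $\mathbb Z/m\mathbb Z$ (this difference does not depend on the representative $x$). *)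

(* Defs.v *)
From HB Require Import structures.
From mathcomp Require Import all_boot all_order all_algebra all_fingroup all_solvable.
Set Implicit Arguments.
Unset Strict Implicit.
Unset Printing Implicit Defensive.
Import GRing.Theory.
Local Open Scope ring_scope.
Local Open Scope quotient_scope.

(* The additive group Z/mZ for m >= 1, including the trivial group when m = 1:
   'Z_m would be Z/2Z there.  For m = 0 the value is junk (the trivial group). *)
Notation Zmod m := ('I_(m.-1.+1)).

Section DirectSum.
Variables (d : nat -> nat) (r : nat).

(* Z/d_1 (+) ... (+) Z/d_r.  Indices start at 1, so the summand of index
   i : 'I_r is Z/d_(i+1); for r = 0 this is the trivial group. *)
Definition direct_sum : Type := {dffun forall i : 'I_r, Zmod (d i.+1)}.
HB.instance Definition _ := Finite.on direct_sum.

Implicit Types x y z : direct_sum.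
Definition dsum_zero : direct_sum := [ffun i : 'I_r => 0 : Zmod (d i.+1)].
Definition dsum_opp x : direct_sum := [ffun i : 'I_r => - x i].
Definition dsum_add x y : direct_sum := [ffun i : 'I_r => x i + y i].

Fact dsum_addA : associative dsum_add.
Proof. by move=> x y z; apply/ffunP=> i; rewrite !ffunE addrA. Qed.
Fact dsum_addC : commutative dsum_add.
Proof. by move=> x y; apply/ffunP=> i; rewrite !ffunE addrC. Qed.
Fact dsum_add0 : left_id dsum_zero dsum_add.
Proof. by move=> x; apply/ffunP=> i; rewrite !ffunE add0r. Qed.
Fact dsum_addN : left_inverse dsum_zero dsum_opp dsum_add.
Proof. by move=> x; apply/ffunP=> i; rewrite !ffunE addNr. Qed.

HB.instance Definition _ :=
  GRing.isZmodule.Build direct_sum dsum_addA dsum_addC dsum_add0 dsum_addN.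
End DirectSum.

Definition isomorphic (U W : zmodType) : Prop :=
  exists phi : {additive U -> W}, bijective phi.

Definition invariant_factor_decomposition (Gamma : zmodType)
    (r : nat) (d : nat -> nat) : Prop :=
  [/\ (0 < r)%N,
      (forall i, (1 <= i < r)%N -> (d i %| d i.+1)%N),
      (forall i, (1 <= i <= r)%N -> (1 < d i)%N) \/ (r = 1%N /\ d 1%N = 1%N)
    & isomorphic Gamma (direct_sum d r)].

(* phi is an injective homomorphism from H into the subgroup K of U. *)
Definition is_embedding (H U : zmodType) (K : {pred U})
    (phi : {additive H -> U}) : Prop :=
  injective phi /\ (forall h, phi h \in K).

Definition embeds (H U : zmodType) (K : {pred U}) : Prop :=
  exists phi : {additive H -> U}, is_embedding K phi.

Section Graph.
Variables (V : finType) (e : rel V).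

Definition simple_graph : Prop := symmetric e /\ irreflexive e.

Definition nbhd (v : V) : {set V} := [set u | e v u].

Definition regular (k : nat) : Prop := forall v, #|nbhd v| = k.

Definition adj (v u : V) : nat := e v u.

Section MagicMaps.
Variable Gamma : finZmodType.
Implicit Type f : V -> Gamma.

Definition magic f : Prop :=
  exists gamma : Gamma, forall v, \sum_(u in nbhd v) f u = gamma.

(* << _ >> is the generated subgroup in the finGroupType of Gamma, whose group
   law is the addition of Gamma. *)
Definition generating f : Prop :=
  <<[set f v | v : V]>>%g = [set: Gamma].

Definition affinely_generating f : Prop :=
  <<[set f v - f w | v : V, w : V]>>%g = [set: Gamma].

Definition distance_magic_labeling f : Prop := magic f /\ bijective f.
End MagicMaps.

Section AdjacencyMod.
Variable m : nat.

Notation Zm := (Zmod m).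
Notation ZmV := {ffun V -> Zmod m}.

(* The subgroup (Z/mZ)1: a multiple a.1 of the all-one vector is the constant
   vector a. *)
Definition const_vec : {pred ZmV} := [pred x | [exists a : Zm, x == [ffun=> a]]].

Fact const_vec_zmod_closed : zmod_closed const_vec.
Proof.
split=> [|x y]; first by apply/existsP; exists 0; apply/eqP/ffunP=> v; rewrite !ffunE.
move=> /existsP[a /eqP->] /existsP[b /eqP->]; apply/existsP; exists (a - b).
by apply/eqP/ffunP=> v; rewrite !ffunE.
Qed.
HB.instance Definition _ :=
  GRing.isZmodClosed.Build ZmV const_vec const_vec_zmod_closed.

(* (Z/mZ)^V / (Z/mZ)1 *)
Definition vec_quot : zmodType := Quotient.quot const_vec.

Definition cls (x : ZmV) : vec_quot := \pi_(Quotient.quot const_vec) x.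
HB.instance Definition _ :=
  GRing.isZmodMorphism.Build ZmV vec_quot cls (pi_is_zmod_morphism _).

Definition rep (c : vec_quot) : ZmV :=
  generic_quotient.repr (c : Quotient.quot const_vec).

Lemma repK : cancel rep cls.
Proof. exact: reprK. Qed.

Lemma cls_eqE (x y : ZmV) : (cls x == cls y) = (x - y \in const_vec).
Proof. by rewrite Quotient.idealrBE. Qed.

Definition Amod (x : ZmV) : ZmV := [ffun v => \sum_u x u *+ adj v u].

Fact Amod_is_zmod_morphism : zmod_morphism Amod.
Proof.
move=> x y; apply/ffunP=> v; rewrite !ffunE -sumrB.
by apply: eq_bigr => u _; rewrite !ffunE mulrnBl.
Qed.
HB.instance Definition _ :=
  GRing.isZmodMorphism.Build ZmV ZmV Amod Amod_is_zmod_morphism.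

(* The map [x] |-> [A_m x].  It is defined through a chosen representative;
   Abar_cls shows that the choice is irrelevant when the graph is regular. *)
Definition Abar (c : vec_quot) : vec_quot := cls (Amod (rep c)).

Lemma Amod_const k (a : Zm) :
  regular k -> Amod [ffun=> a] = [ffun=> a *+ k].
Proof.
move=> reg; apply/ffunP=> v; rewrite !ffunE -(reg v) cardsE -sum1_card.
rewrite -sumrMnr [RHS]big_mkcond; apply: eq_bigr => u _.
by rewrite ffunE /adj unfold_in /=; case: (e v u).
Qed.

Lemma Abar_cls k (x : ZmV) : regular k -> Abar (cls x) = cls (Amod x).
Proof.
move=> reg; apply/eqP; rewrite cls_eqE -raddfB.
have: rep (cls x) - x \in const_vec by rewrite -cls_eqE repK.
case/existsP=> a /eqP->; rewrite /= (Amod_const a reg).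
by apply/existsP; exists (a *+ k).
Qed.

Lemma Abar_is_zmod_morphism k : regular k -> zmod_morphism Abar.
Proof.
move=> reg b c; rewrite -[b in LHS]repK -[c in LHS]repK -raddfB.
by rewrite (Abar_cls _ reg) !raddfB.
Qed.

Definition ker_Abar : {pred vec_quot} := [pred c | Abar c == 0].

Lemma ker_Abar_zmod_closed k : regular k -> zmod_closed ker_Abar.
Proof.
move=> reg; have AbarB := Abar_is_zmod_morphism reg; split=> [|b c].
  by have:= AbarB 0 0; rewrite !subrr inE => ->.
by rewrite !inE => /eqP Ab /eqP Ac; rewrite AbarB Ab Ac subrr.
Qed.

Definition vertex_separating (W : {pred vec_quot}) : Prop :=
  forall v w : V, v != w ->
    exists x : ZmV, cls x \in W /\ x v - x w != 0.
End AdjacencyMod.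
End Graph.

Arguments ker_Abar {V} e m _.

(* Main.v *)
(* Put m = d_r = exp(Gamma) and let < , > be a perfect pairing of Gamma with
   itself into Z/m.  A labeling f corresponds to the homomorphism
   Psi : Gamma -> (Z/m)^V, Psi y v = <f v, y>.  Under this correspondence f is
   magic iff [Psi] maps into the kernel of Abar, generating iff Psi is
   injective, and affinely generating iff [Psi] is injective; every
   homomorphism into the quotient by the constants lifts to (Z/m)^V, so (b) and
   (c) follow.  For (a), if f is generating then the kernel of [Psi] is cyclic,
   and the image of a homomorphism with cyclic kernel contains a copy of
   Z/d_1 + ... + Z/d_(r-1): for every prime power p^(n+1), the number of cyclic
   factors of order divisible by p^(n+1) is the rank of the p-torsion of
   p^n Gamma, and it drops by at most one.  Conversely an embedding of B_Gamma
   extends to Gamma by sending the last summand to the constant vectors. *)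
From HB Require Import structures.
Require Import Defs.
From mathcomp Require Import all_boot all_order all_algebra all_fingroup all_solvable.
From mathcomp Require Import zify.

Set Implicit Arguments.
Unset Strict Implicit.
Unset Printing Implicit Defensive.

Import GRing.Theory.
Local Open Scope ring_scope.

(** * Arithmetic in Z/m and in direct sums of cyclic groups *)

Lemma additive_of_morph (U V : zmodType) (f : U -> V) :
  {morph f : x y / x + y} -> exists g : {additive U -> V}, g =1 f.
Proof.
move=> fD.
have fB : zmod_morphism f.
  by move=> x y; apply: (addIr (f y)); rewrite -fD !subrK.
pose g : {additive U -> V} := HB.pack f (GRing.isZmodMorphism.Build U V f fB).
by exists g.
Qed.

Lemma Zp_eq0 p (x : 'I_p.+1) : (x == 0) = (p.+1 %| x)%N.
Proof. by rewrite -val_eqE /= /dvdn modn_small. Qed.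

Lemma inZp_eq0 p a : ((inZp a : 'I_p.+1) == 0) = (p.+1 %| a)%N.
Proof. by rewrite -val_eqE. Qed.

Lemma inZpD p a b : (inZp (a + b) : 'I_p.+1) = inZp a + inZp b.
Proof. by apply: val_inj; rewrite /= modnDm. Qed.

Lemma inZpMn p a n : (inZp a : 'I_p.+1) *+ n = inZp (a * n).
Proof.
elim: n => [|n IHn]; first by rewrite muln0 mulr0n; apply: val_inj; rewrite /= mod0n.
by rewrite mulrSr IHn mulnSr inZpD.
Qed.

Lemma Zp_mulrn_inZp p (x : 'I_p.+1) n : x *+ n = inZp (x * n).
Proof. by rewrite -{1}(valZpK x) inZpMn. Qed.

Lemma Zp_mulrn_eq0 p (x : 'I_p.+1) n : (x *+ n == 0) = (p.+1 %| x * n)%N.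
Proof. by rewrite Zp_mulrn_inZp inZp_eq0. Qed.

(** Reducing [x + y] modulo [n.+1] changes [c * (x + y)] by a multiple of [c * n.+1], which vanishes
    modulo [m.+1]. *)
Lemma inZp_scaleD m n c : (m.+1 %| c * n.+1)%N ->
  {morph (fun x : 'I_n.+1 => inZp (c * x) : 'I_m.+1) : x y / x + y}.
Proof.
move=> dv x y; rewrite -inZpD -mulnDr; apply: val_inj => /=.
rewrite [in RHS](divn_eq (x + y) n.+1) mulnDr mulnCA -[RHS]modnDml.
by move/(dvdn_mull ((x + y) %/ n.+1)): dv => /eqP->; rewrite add0n.
Qed.

Lemma mulrn_ordD (W : zmodType) (b : W) q (x y : 'I_q.+1) :
  b *+ q.+1 = 0 -> b *+ (x + y)%R = b *+ x + b *+ y.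
Proof.
move=> bq; rewrite -mulrnDr /= [in RHS](divn_eq (x + y) q.+1).
by rewrite mulrnDr mulnC mulrnA bq mul0rn add0r.
Qed.

Lemma dsumD d r (x y : direct_sum d r) i : (x + y) i = x i + y i.
Proof. by rewrite [x + y]/(dsum_add x y) ffunE. Qed.

Lemma dsum0 d r i : (0 : direct_sum d r) i = 0.
Proof. by rewrite [0 in LHS]/(dsum_zero d r) ffunE. Qed.

Lemma dsumMn d r (x : direct_sum d r) n i : (x *+ n) i = x i *+ n.
Proof. by elim: n => [|n IHn]; rewrite ?mulr0n ?dsum0 // !mulrSr dsumD IHn. Qed.

Lemma dsumP d r (x y : direct_sum d r) : (forall i, x i = y i) -> x = y.
Proof. by move=> eq_xy; apply/ffunP. Qed.

(** Homomorphisms out of a direct sum are built this way, the i-th generator going to an element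
    [b i] of order dividing [d i.+1]. Positivity makes [Zmod (d i.+1)] have exactly [d i.+1]
    elements. *)
Lemma dsum_combD d r (W : zmodType) (b : 'I_r -> W) :
  (forall i : 'I_r, (0 < d i.+1)%N) -> (forall i : 'I_r, b i *+ d i.+1 = 0) ->
  {morph (fun x : direct_sum d r => \sum_(i < r) b i *+ x i) : x y / x + y}.
Proof.
move=> d0 bd x y; rewrite -big_split /=; apply: eq_bigr => i _.
rewrite dsumD mulrn_ordD // prednK //.
Qed.

(** * Counting cyclic factors by p-torsion *)

(* The order of [socle p n U] counts the cyclic p-primary factors of order at
   least p^(n+1), whatever decomposition of U is used. *)
Definition socle p n (U : finZmodType) : {set U} :=
  [set x | (x *+ p == 0) && [exists y, x == y *+ p ^ n]].

Lemma socleP p n (U : finZmodType) (x : U) :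
  reflect (x *+ p = 0 /\ exists y, x = y *+ p ^ n) (x \in socle p n U).
Proof.
rewrite inE; apply: (iffP andP) => [[/eqP-> /existsP[y /eqP->]] | [-> [y ->]]].
  by split=> //; exists y.
by split=> //; apply/existsP; exists y.
Qed.

Lemma card_socle_Zp p n q : prime p ->
  #|socle p n 'I_q.+1| = (p ^ (p ^ n.+1 %| q.+1))%N.
Proof.
move=> pr_p; have p0 := prime_gt0 pr_p; case: (boolP (p ^ n.+1 %| q.+1)%N) => [dv|ndv].
  have pq : (p %| q.+1)%N by apply: dvdn_trans dv; rewrite expnS dvdn_mulr.
  (* The p-torsion consists of the p multiples of [c], and these are multiples of [p ^ n] because
     [p ^ n] divides [c]. *)
  pose c := (q.+1 %/ p)%N; have cE : q.+1 = (c * p)%N by rewrite divnK.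
  have c0 : (0 < c)%N by move: (ltn0Sn q); rewrite cE muln_gt0 => /andP[].
  have lt_c (a : 'I_p) : (c * a < q.+1)%N by rewrite cE ltn_pmul2l.
  pose f (a : 'I_p) : 'I_q.+1 := inZp (c * a).
  have fE a : f a = (c * a)%N :> nat by rewrite /= modn_small.
  have injf : injective f.
    move=> a b /(congr1 val); rewrite /= !modn_small // => /eqP.
    by rewrite eqn_pmul2l // => /eqP/val_inj.
  rewrite expn1 -[RHS]card_ord -(card_imset _ injf); apply: eq_card => x.
  apply/socleP/imsetP => [[/eqP] | [a _ ->]].
    rewrite Zp_mulrn_eq0 [X in (X %| _)%N]cE dvdn_pmul2r // => /dvdnP[a xE] _.
    have a_lt : (a < p)%N.
      by have := ltn_ord x; rewrite xE [X in (_ < X)%N]cE [(a * c)%N]mulnC ltn_pmul2l.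
    by exists (Ordinal a_lt) => //; apply: ord_inj; rewrite fE xE mulnC.
  split; first by apply/eqP; rewrite Zp_mulrn_eq0 fE [X in (X %| _)%N]cE mulnAC dvdn_mulr.
  have /dvdnP[e eE] : (p ^ n %| c)%N.
    by rewrite -(dvdn_pmul2r p0) -cE -expnSr.
  by exists (inZp (e * a)); rewrite inZpMn /f eE mulnAC.
rewrite expn0; apply/eqP/cards1P; exists 0; apply/setP => x.
rewrite in_set1; apply/socleP/eqP => [[/eqP px [y xE]] | ->]; last first.
  by rewrite mul0rn; split=> //; exists 0; rewrite mul0rn.
apply/eqP; move: px; rewrite xE -mulrnA -expnSr !Zp_mulrn_eq0 => dv.
(* Since [q.+1] divides [y * p ^ n.+1], it divides [y] times the gcd of [q.+1] and [p ^ n.+1]. This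
   gcd is a power [p ^ j] with [j <= n], so [y * p ^ n] is already zero. *)
case/(dvdn_pfactor _ _ pr_p): (dvdn_gcdr q.+1 (p ^ n.+1)%N) => [j le_jn gE].
have le_j : (j <= n)%N.
  rewrite -ltnS ltn_neqAle le_jn andbT; apply: contra ndv => /eqP jE.
  by rewrite -jE -gE dvdn_gcdl.
have : (q.+1 %| y * gcdn q.+1 (p ^ n.+1))%N.
  by rewrite muln_gcdr dvdn_gcd dv dvdn_mull.
by rewrite gE => /dvdn_trans-> //; rewrite dvdn_mul // dvdn_exp2l.
Qed.

(** Being killed by [p] and being divisible by [p ^ n] are tested coordinatewise, so the socle is
    the product of the socles of the summands. *)
Lemma card_socle_dsum p n d r : prime p -> (forall i : 'I_r, (0 < d i.+1)%N) ->
  #|socle p n (direct_sum d r)| = (p ^ \sum_(i < r) (p ^ n.+1 %| d i.+1))%N.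
Proof.
move=> pr_p d0.
pose F (i : 'I_r) : pred (Zmod (d i.+1)) := mem (socle p n (Zmod (d i.+1))).
have -> : #|socle p n (direct_sum d r)|
    = #|(family F : simpl_pred {dffun forall i : 'I_r, Zmod (d i.+1)})|.
  apply: eq_card => x; apply/socleP/familyP => [[px [y xE]] i | Sx].
    by apply/socleP; rewrite -dsumMn px dsum0; split=> //; exists (y i); rewrite xE dsumMn.
  split; first by apply: dsumP => i; rewrite dsumMn dsum0; case/socleP: (Sx i).
  have yP i : exists y, x i == y *+ p ^ n.
    by case/socleP: (Sx i) => _ [y ->]; exists y.
  exists ([ffun i => xchoose (yP i)] : direct_sum d r); apply: dsumP => i.
  by rewrite dsumMn ffunE; apply/eqP/(xchooseP (yP i)).
rewrite card_family foldrE big_map big_enum /= expn_sum; apply: eq_bigr => i _.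
by rewrite card_socle_Zp // prednK.
Qed.

(** Subtracting one of its points moves each fibre of [q] on [A] injectively into [K]. *)
Lemma card_le_fibres (U W : finZmodType) (q : {additive U -> W}) (A : {set U})
    (B : {set W}) (K : {set U}) :
  (forall x, x \in A -> q x \in B) ->
  (forall x y, x \in A -> y \in A -> q x = q y -> x - y \in K) ->
  (#|A| <= #|B| * #|K|)%N.
Proof.
move=> AB AK; rewrite -sum1_card (partition_big q (mem B)) //= -sum_nat_const.
apply: leq_sum => b _; rewrite sum1_card.
case: (pickP [pred x in A | q x == b]) => [y /andP[Ay /eqP qy] | noy]; last first.
  by rewrite (eq_card0 noy).
rewrite -(card_imset _ (@addIr _ (- y))) subset_leq_card //.
apply/subsetP => _ /imsetP[x /andP[Ax /eqP qx] ->]; apply: AK => //.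
by rewrite qx qy.
Qed.

Lemma card_socle_le p n (U W : finZmodType) (q : {additive U -> W}) :
  (#|socle p n U|
     <= #|socle p n W| * #|[set x : U | (q x == 0%R) && (x *+ p == 0%R)]|)%N.
Proof.
apply: (@card_le_fibres _ _ q) => [x /socleP[px [y xE]] | x y].
  apply/socleP; split; first by rewrite -raddfMn px raddf0.
  by exists (q y); rewrite xE raddfMn.
case/socleP=> px _ /socleP[py _] eq_q.
by rewrite inE raddfB eq_q subrr mulrnBl px py subrr !eqxx.
Qed.

(** * Invariant factors of an image and embeddings into it *)

Lemma dvdn_nth_sorted (t : seq nat) i j :
  sorted (fun m n => n %| m)%N t -> (i <= j)%N -> (nth 1 t j %| nth 1 t i)%N.
Proof.
move=> st le_ij; case: (ltnP j (size t)) => [lt_j | ge_j]; last first.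
  by rewrite [nth 1 t j]nth_default // dvd1n.
apply: (@sorted_leq_nth _ _ _ _ 1%N _ st) => //; rewrite ?inE ?(leq_ltn_trans le_ij) //.
by move=> a b c ba ac; apply: dvdn_trans ac ba.
Qed.

(** The structure theorem for finite abelian groups, applied to the image of [h]. The factors [c]
    come largest first, opposite to the order in [invariant_factor_decomposition]. *)
Lemma image_structure (U W : finZmodType) (h : {additive U -> W}) :
  exists s c (psi : {additive direct_sum c s -> W}),
    [/\ forall i, (0 < c i)%N, forall i j, (1 <= i <= j)%N -> (c j %| c i)%N,
        injective psi, forall x, exists y, psi x = h y
      & forall y, exists x, h y = psi x].
Proof.
have groupE : group_set (h @: [set: U]).
  apply/group_setP; split; first by apply/imsetP; exists 0; rewrite ?raddf0.
  move=> _ _ /imsetP[x _ ->] /imsetP[y _ ->].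
  by apply/imsetP; exists (x + y); rewrite ?raddfD.
pose E := Group groupE.
have abE : abelian E := FinRing.zmod_abelian _.
have [b defE typeE] := abelian_structure abE.
(* Indices are shifted to start at 1. The default 1 stands for trivial factors past the end, so
   positivity and divisibility hold at every index. *)
pose c i := nth 1%N (map order b) i.-1.
have cE (i : 'I_(size b)) : c i.+1 = #[nth 0 b i]%g.
  by rewrite /c (nth_map (0 : W)) /=.
have c0 i : (0 < c i)%N.
  rewrite /c; case: (ltnP i.-1 (size b)) => [lt_i | ge_i].
    by rewrite (nth_map (0 : W)) // order_gt0.
  by rewrite nth_default // size_map.
have [psi psiE] : exists psi : {additive direct_sum c (size b) -> W},
    psi =1 fun x => \sum_(i < size b) nth 0 b i *+ x i.
  apply: additive_of_morph; apply: dsum_combD => // i.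
  by rewrite cE -FinRing.zmodXgE expg_order.
have defE' : (\big[dprod/1]_(i < size b) <[nth 0%R b i]>)%g = E.
  by rewrite -defE (big_nth 0) big_mkord.
have psiEim x : psi x \in E.
  have bE (i : 'I_(size b)) : exists y, nth 0 b i == h y.
    have : nth 0 b i \in E.
      by rewrite -(bigdprodWY defE'); apply/mem_gen/bigcupP; exists i; rewrite ?cycle_id.
    by case/imsetP=> y _ ->; exists y.
  apply/imsetP; exists (\sum_(i < size b) xchoose (bE i) *+ x i) => //.
  rewrite psiE raddf_sum; apply: eq_bigr => i _.
  by rewrite raddfMn -(eqP (xchooseP (bE i))).
have psi_onto y : y \in E -> exists x, y = psi x.
  case/(mem_bigdprod defE') => a [aE -> _].
  have kP (i : 'I_(size b)) : exists k : Zmod (c i.+1), a i == nth 0 b i *+ k.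
    have /cyclePmin[k lt_k ->] := aE i isT.
    rewrite -(cE i) -(prednK (c0 i.+1)) in lt_k.
    by exists (Ordinal lt_k); rewrite FinRing.zmodXgE.
  exists ([ffun i => xchoose (kP i)] : direct_sum c (size b)).
  rewrite psiE; apply: eq_bigr => i _; rewrite ffunE.
  exact: (eqP (xchooseP (kP i))).
exists (size b), c, psi; split=> //; last first.
- by move=> y; apply: psi_onto; apply/imsetP; exists y.
- by move=> x; case/imsetP: (psiEim x) => y _ ->; exists y.
(* [psi] maps onto [E], and its source has the order of [E], so it is injective. *)
- suff /imset_injP injpsi : #|psi @: [set: direct_sum c (size b)]|
      == #|[set: direct_sum c (size b)]|.
    by move=> x y; apply: injpsi; rewrite inE.
  have -> : psi @: [set: direct_sum c (size b)] = E.
    apply/setP=> y; apply/imsetP/idP => [[x _ ->] // | /psi_onto[x ->]].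
    by exists x.
  rewrite -(bigdprod_card defE') cardsT card_dep_ffun foldrE big_map big_enum.
  by apply/eqP/eq_bigr => i _; rewrite card_ord prednK // cE.
move=> i j /andP[i1 le_ij]; apply: dvdn_nth_sorted; last by rewrite -!subn1 leq_sub2r.
by rewrite typeE abelian_type_dvdn_sorted.
Qed.

Lemma sum_ltn_le s J : (\sum_(k < s) (k < J) <= J)%N.
Proof.
suff -> : (\sum_(k < s) (k < J) = minn s J)%N by exact: geq_minr.
elim: s => [|s IHs]; first by rewrite big_ord0 min0n.
by rewrite big_ord_recr /= IHs; case: (ltnP s J); lia.
Qed.

Lemma chain_dvdn r (d : nat -> nat) i j :
  (forall i, (1 <= i < r)%N -> (d i %| d i.+1)%N) ->
  (1 <= i)%N -> (i <= j <= r)%N -> (d i %| d j)%N.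
Proof.
move=> chain i1 /andP[]; elim: j => [|j IHj]; first by rewrite leqn0 => /eqP->.
rewrite leq_eqVlt => /predU1P[-> // | le_ij lt_jr].
by apply: dvdn_trans (IHj le_ij (ltnW lt_jr)) _; rewrite chain // lt_jr (leq_trans i1).
Qed.

Lemma dsum_sum d s (I : finType) (F : I -> direct_sum d s) j :
  (\sum_i F i) j = \sum_i F i j.
Proof.
by apply: (big_morph (fun x : direct_sum d s => x j)) => [x y|]; rewrite ?dsumD ?dsum0.
Qed.

(* Each p-power dividing at least k of the d_i divides at least k - 1 of the
   c_j, since passing to the image costs at most a factor p in the socle. *)
Lemma pfactor_dvdn_image d r c s (q : {additive direct_sum d r -> direct_sum c s})
    p n i :
  prime p ->
  (forall i, (1 <= i <= r)%N -> (0 < d i)%N) ->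
  (forall i, (1 <= i < r)%N -> (d i %| d i.+1)%N) ->
  (forall i, (0 < c i)%N) ->
  (forall i j, (1 <= i <= j)%N -> (c j %| c i)%N) ->
  (#|[set x : direct_sum d r | (q x == 0%R) && (x *+ p == 0%R)]| <= p)%N ->
  (i < r.-1)%N -> (p ^ n.+1 %| d i.+1)%N ->
  (r.-1 - i.+1 < s)%N /\ (p ^ n.+1 %| c (r.-1 - i.+1).+1)%N.
Proof.
move=> pr_p d0 chain_d c0 chain_c kerq lt_ir pd; have p1 := prime_gt1 pr_p.
(* Position [J] mirrors [i] among the first [r.-1] entries, as [c] decreases. If the claim fails, at
   most [J] of the [c] are divisible by [p ^ n.+1], while at least [r - i = J + 2] of the [d]
   are. *)
set J := (r.-1 - i.+1)%N; apply/andP; apply: contraT => notJ.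
have d0' (k : 'I_r) : (0 < d k.+1)%N by apply: d0; rewrite ltn_ord.
have c0' (k : 'I_s) : (0 < c k.+1)%N by [].
(* Comparing exponents of [p] in the socle orders: the count for [d] exceeds the count for [c] by at
   most one. *)
have := leq_trans (card_socle_le p n q) (leq_mul (leqnn _) kerq).
rewrite !card_socle_dsum // -expnSr leq_exp2l // => le_dc.
have ge_d : (r - i <= \sum_(k < r) (p ^ n.+1 %| d k.+1))%N.
  rewrite -(big_mkord xpredT (fun k => nat_of_bool (p ^ n.+1 %| d k.+1)%N)).
  have le_ir : (i <= r)%N by rewrite (leq_trans (ltnW lt_ir)) ?leq_pred.
  rewrite (big_cat_nat (n := i)) //=; apply: leq_trans (leq_addl _ _).
  rewrite -[(r - i)%N]muln1 -sum_nat_const_nat big_nat_cond [X in (_ <= X)%N]big_nat_cond.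
  apply: leq_sum => k /andP[/andP[le_ik lt_kr] _].
  by rewrite (dvdn_trans pd) // (@chain_dvdn r) // ltnS le_ik lt_kr.
have le_c : (\sum_(k < s) (p ^ n.+1 %| c k.+1) <= J)%N.
  apply: leq_trans (sum_ltn_le s J); apply: leq_sum => k _.
  case: (ltnP k J) => [_ | le_Jk]; first exact: leq_b1.
  case: (boolP (_ %| _)%N) => // pc; case/negP: notJ.
  by rewrite (leq_ltn_trans le_Jk) // (dvdn_trans pc) // chain_c.
have := leq_trans ge_d (leq_trans le_dc (leq_ltn_trans le_c (ltnSn _))).
by rewrite /J; lia.
Qed.

(** Each of the first [r.-1] factors [d i.+1] divides the mirrored factor of the image, so its
    cyclic group embeds in that summand. Distinct indices use distinct summands, hence the whole sum
    embeds. *)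
Lemma embed_of_small_kernel d r (W : finZmodType) (h : {additive direct_sum d r -> W}) :
  (forall i, (1 <= i <= r)%N -> (0 < d i)%N) ->
  (forall i, (1 <= i < r)%N -> (1 < d i)%N) ->
  (forall i, (1 <= i < r)%N -> (d i %| d i.+1)%N) ->
  (forall p, prime p ->
     #|[set x : direct_sum d r | (h x == 0%R) && (x *+ p == 0%R)]| <= p)%N ->
  exists g : {additive direct_sum d r.-1 -> W},
    injective g /\ forall x, exists y, g x = h y.
Proof.
move=> d0 d1 chain_d kerh.
have [s [c [psi [c0 chain_c inj_psi psi_h h_psi]]]] := image_structure h.
(* [q] is [h] with its image identified with [direct_sum c s] through [psi]. *)
have qP y : exists x, h y == psi x by case: (h_psi y) => x ->; exists x.
pose q0 y := xchoose (qP y).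
have q0E y : psi (q0 y) = h y by rewrite (eqP (xchooseP (qP y))).
have [q qE] : exists q : {additive direct_sum d r -> direct_sum c s}, q =1 q0.
  by apply: additive_of_morph => x y; apply: inj_psi; rewrite raddfD !q0E raddfD.
have psi_q y : psi (q y) = h y by rewrite qE.
have kerq p : prime p ->
    (#|[set x : direct_sum d r | (q x == 0%R) && (x *+ p == 0%R)]| <= p)%N.
  move=> pr_p; apply: leq_trans (kerh p pr_p); apply: subset_leq_card.
  by apply/subsetP => x; rewrite !inE -psi_q => /andP[/eqP-> ->]; rewrite raddf0 eqxx.
have d0' (i : 'I_r.-1) : (0 < d i.+1)%N.
  by apply: d0; rewrite (leq_trans (ltn_ord i)) ?leq_pred.
have lt_s (i : 'I_r.-1) : (r.-1 - i.+1 < s)%N.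
  have lt_i : (1 < d i.+1)%N.
    by apply: d1; move: (ltn_ord i); lia.
  (* Any prime divisor of [d i.+1 > 1], taken to the first power, shows that the mirrored position
     exists in [c]. *)
  have := pdiv_dvd (d i.+1); rewrite -[X in (X %| _)%N]expn1 => pd.
  by case: (pfactor_dvdn_image (pdiv_prime lt_i) d0 chain_d c0 chain_c
              (kerq _ (pdiv_prime lt_i)) (ltn_ord i) pd).
pose j i := Ordinal (lt_s i).
have dv (i : 'I_r.-1) : (d i.+1 %| c (j i).+1)%N.
  apply/dvdn_partP => // p; rewrite mem_primes => /and3P[pr_p _ pd].
  rewrite p_part; case def_n: (logn p (d i.+1)) => [|n]; first by rewrite dvd1n.
  have pd' : (p ^ n.+1 %| d i.+1)%N by rewrite -def_n pfactor_dvdnn.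
  by case: (pfactor_dvdn_image pr_p d0 chain_d c0 chain_c
              (kerq _ pr_p) (ltn_ord i) pd').
have inj_j : injective j.
  move=> a b /(congr1 val) /= eq_ab; apply: (can_inj rev_ordK); exact: val_inj.
(* [e i] has order [d i.+1] and is supported on the summand [j i]. *)
pose e (i : 'I_r.-1) : direct_sum c s :=
  [ffun k : 'I_s => inZp ((k == j i) * (c (j i).+1 %/ d i.+1)) : Zmod (c k.+1)].
have [k kE] : exists k : {additive direct_sum d r.-1 -> direct_sum c s},
    k =1 fun x => \sum_(i < r.-1) e i *+ x i.
  apply: additive_of_morph; apply: dsum_combD => // i.
  apply: dsumP => l; rewrite dsumMn dsum0 ffunE inZpMn; apply/eqP; rewrite inZp_eq0.
  case: (l =P j i) => [->|_]; last by rewrite !mul0n dvdn0.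
  by rewrite mul1n divnK // prednK.
have [g gE] : exists g : {additive direct_sum d r.-1 -> W}, g =1 psi \o k.
  by apply: additive_of_morph => x y /=; rewrite !raddfD.
exists g; split=> [|x]; last by rewrite gE; apply: psi_h.
apply: raddf_inj => x; rewrite gE /= -(raddf0 psi) => /inj_psi kx0.
apply: dsumP => i; rewrite dsum0; apply/eqP; rewrite Zp_eq0 [X in (X %| _)%N]prednK //.
have : k x (j i) = 0 by rewrite kx0 dsum0.
rewrite kE dsum_sum (bigD1 i) //= big1 => [|i' neq_i].
  rewrite addr0 dsumMn ffunE eqxx mul1n inZpMn => /eqP.
  rewrite inZp_eq0 [X in (X %| _)%N]prednK //.
  rewrite -{1}(divnK (dv i)) dvdn_pmul2l // divn_gt0 //.
  exact: dvdn_leq (dv i).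
rewrite dsumMn ffunE; case: eqP => [/inj_j eq_i | _]; first by rewrite eq_i eqxx in neq_i.
by rewrite mul0n inZpMn mul0n; apply/eqP; rewrite inZp_eq0.
Qed.

(** * Perfect pairing of a finite abelian group with itself *)

Definition dsum_unit d r (i : 'I_r) : direct_sum d r :=
  [ffun k : 'I_r => inZp (k == i) : Zmod (d k.+1)].

Lemma dsum_unit_comb d r (x : direct_sum d r) :
  x = \sum_(i < r) dsum_unit d i *+ x i.
Proof.
apply: dsumP => j; rewrite dsum_sum (bigD1 j) //= big1 => [|i neq_ij].
  by rewrite addr0 dsumMn ffunE eqxx inZpMn mul1n valZpK.
by rewrite dsumMn ffunE eq_sym (negPf neq_ij) inZpMn mul0n; apply/eqP; rewrite inZp_eq0.
Qed.

Lemma dsum_unit_order d r (i : 'I_r) : (0 < d i.+1)%N -> dsum_unit d i *+ d i.+1 = 0.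
Proof.
move=> d0; apply: dsumP => k; rewrite dsumMn ffunE dsum0 inZpMn; apply/eqP.
rewrite inZp_eq0; case: (k =P i) => [->|_]; last by rewrite mul0n dvdn0.
by rewrite mul1n prednK.
Qed.

(** The pairing is the sum of [(m / d_i) * x_i * y_i]. Pairing with the unit vectors recovers each
    coordinate of [x] modulo [d_i], which gives nondegeneracy. *)
Lemma dsum_pairing d r m :
  (0 < m)%N -> (forall i : 'I_r, (0 < d i.+1)%N && (d i.+1 %| m)%N) ->
  exists b : direct_sum d r -> direct_sum d r -> Zmod m,
    [/\ forall x y, b x y = b y x, forall y, {morph b^~ y : x x' / x + x'},
        forall x, (forall y, b x y = 0) -> x = 0
      & forall chi : {additive direct_sum d r -> Zmod m},
          exists x, forall y, b x y = chi y].
Proof.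
move=> m0 dm.
have d0 (i : 'I_r) : (0 < d i.+1)%N by case/andP: (dm i).
have dvm (i : 'I_r) : (d i.+1 %| m)%N by case/andP: (dm i).
have md0 (i : 'I_r) : (0 < m %/ d i.+1)%N by rewrite divn_gt0 // dvdn_leq.
pose b (x y : direct_sum d r) : Zmod m :=
  \sum_(i < r) inZp (m %/ d i.+1 * (x i * y i)).
exists b; split.
- by move=> x y; apply: eq_bigr => i _; rewrite [(x i * _)%N]mulnC.
- move=> y x x'; rewrite /b -big_split /=; apply: eq_bigr => i _.
  rewrite dsumD ![(_ * y i)%N]mulnC !mulnA.
  apply: (inZp_scaleD (n := (d i.+1).-1)).
  by rewrite (prednK m0) [X in (_ * X)%N]prednK // mulnAC divnK // dvdn_mulr.
- move=> x bx0; apply: dsumP => i; rewrite dsum0; apply/eqP.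
  rewrite Zp_eq0 [X in (X %| _)%N]prednK //.
  have := bx0 (dsum_unit d i).
  rewrite /b (bigD1 i) //= big1 => [|k neq_ki]; last first.
    by rewrite ffunE (negPf neq_ki) /= mod0n !muln0; apply/eqP; rewrite inZp_eq0.
  rewrite addr0 ffunE eqxx => /eqP; rewrite inZp_eq0 /= [X in (X %| _)%N]prednK //.
  rewrite -{1}(divnK (dvm i)) dvdn_pmul2l // [X in (_ %% X)%N]prednK //.
  by rewrite /dvdn modnMmr muln1.
(* The value of [chi] at a unit vector is killed by [d i.+1], hence is a multiple of [m %/ d i.+1];
   the quotient is the coordinate of the representing element. *)
move=> chi; pose a i := chi (dsum_unit d i).
have a_dv (i : 'I_r) : (m %/ d i.+1 %| a i)%N.
  have /eqP : a i *+ d i.+1 = 0 by rewrite -raddfMn dsum_unit_order ?raddf0.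
  rewrite Zp_mulrn_eq0 [X in (X %| _)%N]prednK //.
  by rewrite -{1}(divnK (dvm i)) dvdn_pmul2r.
exists ([ffun i : 'I_r => inZp (a i %/ (m %/ d i.+1)) : Zmod (d i.+1)]) => y.
rewrite [in RHS](dsum_unit_comb y) raddf_sum; apply: eq_bigr => i _.
rewrite raddfMn -/(a i) Zp_mulrn_inZp ffunE /= modn_small ?mulnA; last first.
  rewrite (prednK (d0 i)) ltn_divLR // mulnC divnK //.
  by have := ltn_ord (a i); rewrite [X in (_ < X)%N]prednK.
by rewrite [(_ * (_ %/ _))%N]mulnC divnK.
Qed.

Lemma perfect_pairing (Gamma : zmodType) r d m :
  (0 < m)%N -> (forall i : 'I_r, (0 < d i.+1)%N && (d i.+1 %| m)%N) ->
  isomorphic Gamma (direct_sum d r) ->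
  exists b : Gamma -> Gamma -> Zmod m,
    [/\ forall x y, b x y = b y x, forall y, {morph b^~ y : x x' / x + x'},
        forall x, (forall y, b x y = 0) -> x = 0
      & forall chi : {additive Gamma -> Zmod m}, exists x, forall y, b x y = chi y].
Proof.
move=> m0 dm [phi [psi phiK psiK]].
have [b [bC bD b_nd b_rep]] := dsum_pairing m0 dm.
exists (fun x y => b (phi x) (phi y)); split=> [x y | y x x' | x bx0 | chi].
- exact: bC.
- by rewrite raddfD bD.
- apply: (can_inj phiK); rewrite raddf0; apply: b_nd => y.
  by rewrite -(psiK y) bx0.
have [chi' chiE] : exists chi' : {additive direct_sum d r -> Zmod m}, chi' =1 chi \o psi.
  apply: additive_of_morph => x y /=; rewrite -raddfD; congr (chi _).
  by apply: (can_inj phiK); rewrite raddfD !psiK.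
by have [x xE] := b_rep chi'; exists (psi x) => y; rewrite psiK xE chiE /= phiK.
Qed.

(** * Characters and generation *)

(* The quotient by a maximal subgroup containing H is cyclic of prime order
   dividing m, hence embeds in Z/m. *)
Lemma separating_character (Gamma : finZmodType) (H : {group Gamma}) m :
  (0 < m)%N -> (exponent [set: Gamma] %| m)%N -> H != [set: Gamma] :> {set Gamma} ->
  exists chi : {additive Gamma -> Zmod m},
    (forall x, x \in H -> chi x = 0) /\ exists x, chi x != 0.
Proof.
move=> m0 exp_m neqH; pose G := [set: Gamma]%G.
have abG : abelian G := FinRing.zmod_abelian _.
have nmlG (K : {group Gamma}) : (K <| G)%g by rewrite -sub_abelian_normal ?subsetT.
have gH : (H \proper G) && (G \subset 'N(H))%g.
  by rewrite properEneq neqH subsetT normal_norm.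
pose gP (K : {group Gamma}) := (K \proper G) && (G \subset 'N(K))%g.
have [M maxM sHM] := maxgroup_exists (gP := gP) gH.
have simM : simple (G / M)%g by rewrite quotient_simple.
have abM : abelian (G / M)%g by rewrite quotient_abelian.
have pr_p := simple_sol_prime (abelian_sol abM) simM.
set p := #|(G / M)%g| in pr_p.
have /cyclicP[z defz] := prime_cyclic pr_p.
have oz : #[z]%g = p by rewrite /p defz.
have /morphimP[x _ _ zE] : z \in (G / M)%g by rewrite defz cycle_id.
have p_m : (p %| m)%N.
  apply: dvdn_trans exp_m; rewrite -oz; apply: dvdn_trans (exponent_quotient G M).
  by apply: dvdn_exponent; rewrite defz cycle_id.
(* The character sends the generator [z] of the quotient to [w], which is nonzero and killed by
   [p]. *)
pose w : Zmod m := inZp (m %/ p).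
have w_z : (#[w]%g %| #[z]%g)%N.
  rewrite oz order_dvdn FinRing.zmodXgE inZpMn divnK //.
  by rewrite -val_eqE /= prednK // modnn.
have [chi chiE] : exists chi : {additive Gamma -> Zmod m}, chi =1 eltm w_z \o coset M.
  have inM y : coset M y \in <[z]>%g by rewrite -defz mem_quotient ?inE.
  apply: additive_of_morph => y y' /=.
  rewrite -FinRing.zmodMgE morphM ?(subsetP (normal_norm (nmlG M))) ?inE //.
  by rewrite morphM ?inM.
exists chi; split=> [y Hy|].
  by rewrite chiE /= coset_id ?(subsetP sHM) // morph1.
have mp0 : (0 < m %/ p)%N by rewrite divn_gt0 ?prime_gt0 // dvdn_leq.
have mp_m : (m %/ p < m)%N by rewrite ltn_Pdiv ?prime_gt1.
exists x; rewrite chiE /= -zE eltm_id inZp_eq0 (prednK m0).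
by rewrite (gtnNdvd mp0 mp_m).
Qed.

(* Declares the missing join: {ffun V -> W} is a finZmodType. *)
HB.instance Definition _ (V : finType) (W : finZmodType) :=
  GRing.Zmodule.on {ffun V -> W}.

(** The elements pairing to zero with [y] form a subgroup, so they contain [<<S>>] once they contain
    [S]. Conversely, a nonzero character trivial on a proper [<<S>>] is represented by a nonzero [y]
    annihilating [S]. *)
Lemma generatedP (Gamma : finZmodType) m (b : Gamma -> Gamma -> Zmod m)
    (S : {set Gamma}) :
  (0 < m)%N -> (exponent [set: Gamma] %| m)%N ->
  (forall x y, b x y = b y x) -> (forall y, {morph b^~ y : x x' / x + x'}) ->
  (forall x, (forall y, b x y = 0) -> x = 0) ->
  (forall chi : {additive Gamma -> Zmod m}, exists x, forall y, b x y = chi y) ->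
  <<S>>%g = [set: Gamma] <-> (forall y, (forall x, x \in S -> b x y = 0) -> y = 0).
Proof.
move=> m0 exp_m bC bD b_nd b_rep; split=> [genS y bS0 | S_nd].
  apply: b_nd => x; rewrite bC; have [beta betaE] := additive_of_morph (bD y).
  have gK : group_set [set x | beta x == 0].
    apply/group_setP; split=> [|a c]; first by rewrite inE raddf0.
    by rewrite !inE FinRing.zmodMgE raddfD => /eqP-> /eqP->; rewrite addr0.
  have : x \in <<S>>%g by rewrite genS inE.
  have /subsetP sub : <<S>>%g \subset Group gK.
    by rewrite gen_subG; apply/subsetP => a Sa; rewrite inE betaE bS0.
  by move/sub; rewrite inE betaE => /eqP.
apply/eqP; apply: contraT => neqS.
have [chi [chi0 [x]]] := separating_character m0 exp_m neqS.
have [y yE] := b_rep chi; rewrite -yE.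
have -> : y = 0 by apply: S_nd => a Sa; rewrite bC yE chi0 ?mem_gen.
by have [beta betaE] := additive_of_morph (bD x); rewrite -betaE raddf0 eqxx.
Qed.

(** * The quotient by the constant vectors *)

Lemma const_vecP (V : finType) m (x : {ffun V -> Zmod m}) (v0 : V) :
  reflect (forall v, x v = x v0) (x \in @const_vec V m).
Proof.
apply: (iffP existsP) => [[a /eqP->] v | xE]; first by rewrite !ffunE.
by exists (x v0); apply/eqP/ffunP => v; rewrite ffunE xE.
Qed.

Lemma cls_eq0 (V : finType) m (x : {ffun V -> Zmod m}) :
  (cls x == 0) = (x \in @const_vec V m).
Proof. by rewrite -(raddf0 (@cls V m)) cls_eqE subr0. Qed.

(** Each class has exactly one representative vanishing at [v0], so choosing it is additive. This
    section lifts homomorphisms from the quotient to vectors. *)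
Lemma cls_section (V : finType) m (v0 : V) :
  exists s : {additive vec_quot V m -> {ffun V -> Zmod m}},
    cancel s (@cls V m) /\ forall c, s c v0 = 0.
Proof.
pose s0 (c : vec_quot V m) : {ffun V -> Zmod m} := rep c - [ffun=> rep c v0].
have s0E c v : s0 c v = rep c v - rep c v0 by rewrite !ffunE.
have [s sE] : exists s : {additive vec_quot V m -> {ffun V -> Zmod m}}, s =1 s0.
  apply: additive_of_morph => c c'; apply/ffunP => v; rewrite [RHS]ffunE !s0E.
  have : rep (c + c') - (rep c + rep c') \in @const_vec V m.
    by rewrite -cls_eqE; apply/eqP; rewrite raddfD /= !repK.
  move/(const_vecP _ v0)/(_ v); rewrite !ffunE => eq_v.
  rewrite [RHS]addrACA -opprD -[X in X - _](subrK (rep c v + rep c' v)) eq_v.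
  by rewrite [LHS]addrAC [_ - _ - rep (c + c') v0]addrAC subrr sub0r addrC.
exists s; split=> c; last by rewrite sE s0E subrr.
apply/eqP; rewrite -[in X in _ == X](repK c) cls_eqE; apply/(const_vecP _ v0) => v.
by rewrite !ffunE !sE !s0E subrr sub0r addrAC subrr sub0r.
Qed.

Lemma ker_Abar_cls (V : finType) (e : rel V) m k (x : {ffun V -> Zmod m}) :
  regular e k -> (cls x \in ker_Abar e m) = (Amod e x \in @const_vec V m).
Proof. by move=> reg; rewrite inE (Abar_cls _ reg) cls_eq0. Qed.

(** * Duality between labelings and homomorphisms *)

(* The labelings f : V -> Gamma correspond to the homomorphisms
   Psi : Gamma -> (Z/m)^V through Psi y v = <f v, y> for a perfect pairing
   Gamma x Gamma -> Z/m. *)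
Definition dual_labeling (V : finType) (e : rel V) (Gamma : finZmodType) m
    (f : V -> Gamma) (Psi : {additive Gamma -> {ffun V -> Zmod m}}) : Prop :=
  [/\ magic e f <-> (forall y, cls (Psi y) \in ker_Abar e m),
      generating f <-> injective Psi,
      affinely_generating f <-> injective (@cls V m \o Psi)
    & forall v w, f v = f w <-> forall y, Psi y v = Psi y w].

(** Pairing with [y] commutes with neighbourhood sums, which settles the magic clause. The
    generation clauses are [generatedP] for the values of [f] and for their differences. Perfectness
    recovers [f v] from the character [y |-> Psi y v]. *)
Lemma labeling_duality (V : finType) (e : rel V) (Gamma : finZmodType) m
    k (v0 : V) r d :
  regular e k -> (0 < m)%N -> (exponent [set: Gamma] %| m)%N ->
  (forall i : 'I_r, (0 < d i.+1)%N && (d i.+1 %| m)%N) ->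
  isomorphic Gamma (direct_sum d r) ->
  (forall f : V -> Gamma,
     exists Psi : {additive Gamma -> {ffun V -> Zmod m}}, dual_labeling e f Psi) /\
  (forall Psi : {additive Gamma -> {ffun V -> Zmod m}},
     exists f : V -> Gamma, dual_labeling e f Psi).
Proof.
move=> reg m0 exp_m dm isoG.
have [b [bC bD b_nd b_rep]] := perfect_pairing m0 dm isoG.
have genP S := generatedP S m0 exp_m bC bD b_nd b_rep.
have b0 y : b 0 y = 0.
  by have [beta betaE] := additive_of_morph (bD y); rewrite -betaE raddf0.
have bB x x' y : b (x - x') y = b x y - b x' y.
  by have [beta betaE] := additive_of_morph (bD y); rewrite -!betaE raddfB.
have b_eq x x' : (forall y, b x y = b x' y) -> x = x'.
  by move=> eq_b; apply/eqP; rewrite -subr_eq0; apply/eqP/b_nd => y; rewrite bB eq_b subrr.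
have duality f (Psi : {additive Gamma -> {ffun V -> Zmod m}}) :
    (forall y v, Psi y v = b (f v) y) -> dual_labeling e f Psi.
  move=> PsiE.
  have AE y v : Amod e (Psi y) v = b (\sum_(u in nbhd e v) f u) y.
    rewrite ffunE (big_morph (b^~ y) (bD y) (b0 y)) [RHS]big_mkcond /=.
    by apply: eq_bigr => u _; rewrite inE PsiE /adj; case: (e v u).
  split.
  - split=> [[gamma fE] y | Psi_ker].
      by rewrite (ker_Abar_cls _ reg); apply/(const_vecP _ v0) => v; rewrite !AE !fE.
    exists (\sum_(u in nbhd e v0) f u) => v; apply: b_eq => y; rewrite -!AE.
    by apply/const_vecP; rewrite -(ker_Abar_cls _ reg).
  - rewrite /generating genP; split=> [f_nd | inj_Psi y fy0].
      apply: raddf_inj => y Psi0; apply: f_nd => _ /imsetP[v _ ->].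
      by rewrite -PsiE Psi0 ffunE.
    apply: inj_Psi; rewrite raddf0; apply/ffunP => v.
    by rewrite PsiE ffunE fy0 // imset_f.
  - rewrite /affinely_generating genP; split=> [f_nd | inj_Psi y fy0].
      apply: raddf_inj => y /= /eqP; rewrite cls_eq0 => /(const_vecP _ v0) Psi_c.
      apply: f_nd => _ /imset2P[v w _ _ ->].
      by rewrite bB -!PsiE !(Psi_c _) subrr.
    apply: inj_Psi; rewrite /= !raddf0; apply/eqP; rewrite cls_eq0.
    apply/(const_vecP _ v0) => v; rewrite !PsiE; apply/eqP.
    by rewrite -subr_eq0 -bB fy0 //; apply/imset2P; exists v v0.
  - move=> v w; split=> [eq_f y | eq_Psi]; first by rewrite !PsiE eq_f.
    by apply: b_eq => y; rewrite -!PsiE.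
split=> [f | Psi].
  have [Psi PsiE] : exists Psi : {additive Gamma -> {ffun V -> Zmod m}},
      Psi =1 fun y => [ffun v => b (f v) y].
    apply: additive_of_morph => y y'; apply/ffunP => v.
    by rewrite !ffunE bC bD bC [b y' _]bC.
  by exists Psi; apply: duality => y v; rewrite PsiE ffunE.
have fP v : exists x, [forall y, b x y == Psi y v].
  have [chi chiE] : exists chi : {additive Gamma -> Zmod m}, chi =1 fun y => Psi y v.
    by apply: additive_of_morph => y y'; rewrite raddfD ffunE.
  by have [x xE] := b_rep chi; exists x; apply/forallP => y; rewrite xE chiE.
exists (fun v => xchoose (fP v)); apply: duality => y v.
by apply/esym/eqP; move: y; apply/forallP/(xchooseP (fP v)).
Qed.

(** * Exponent, truncation and the three equivalences *)

Lemma additive_bij_inv (U W : zmodType) (phi : {additive U -> W}) :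
  bijective phi -> exists psi : {additive W -> U}, cancel phi psi /\ cancel psi phi.
Proof.
case=> psi0 phiK psi0K.
have [psi psiE] : exists psi : {additive W -> U}, psi =1 psi0.
  by apply: additive_of_morph => x y; apply: (can_inj phiK); rewrite raddfD !psi0K.
by exists psi; split=> x; rewrite psiE.
Qed.

(** The last unit vector has order [d r.+1], and every other factor divides [d r.+1]. *)
Lemma exponent_decomposition (Gamma : finZmodType) r d :
  (forall i, (1 <= i <= r.+1)%N -> (0 < d i)%N) ->
  (forall i, (1 <= i < r.+1)%N -> (d i %| d i.+1)%N) ->
  isomorphic Gamma (direct_sum d r.+1) -> d r.+1 = exponent [set: Gamma].
Proof.
move=> d0 chain_d [phi /additive_bij_inv[psi [phiK psiK]]].
have dr0 : (0 < d r.+1)%N by apply: d0; rewrite leqnn.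
apply/eqP; rewrite eqn_dvd; apply/andP; split.
  have : phi (psi (dsum_unit d (ord_max : 'I_r.+1)) *+ exponent [set: Gamma]) ord_max = 0.
    have -> : psi (dsum_unit d ord_max) *+ exponent [set: Gamma] = 0.
      by rewrite -FinRing.zmodXgE expg_exponent ?inE.
    by rewrite raddf0 dsum0.
  move/eqP; rewrite raddfMn /= psiK dsumMn ffunE eqxx inZpMn mul1n inZp_eq0.
  by rewrite /= prednK.
apply/exponentP => x _; rewrite FinRing.zmodXgE FinRing.zmod1gE.
apply: (can_inj phiK); rewrite raddfMn raddf0; apply: dsumP => i.
rewrite dsumMn dsum0; apply/eqP; rewrite Zp_mulrn_eq0 dvdn_mull //.
rewrite prednK; last by rewrite d0 //= ltn_ord.
by apply: (chain_dvdn chain_d); rewrite //= ltn_ord leqnn.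
Qed.

Lemma card_torsion_Zp p q : prime p -> (#|[set a : 'I_q.+1 | a *+ p == 0%R]| <= p)%N.
Proof.
move=> pr_p; apply: leq_trans (_ : #|socle p 0 'I_q.+1| <= p)%N.
  apply: subset_leq_card; apply/subsetP => a; rewrite inE => /eqP pa.
  by apply/socleP; split=> //; exists a.
by rewrite card_socle_Zp // -[X in (_ <= X)%N]expn1 leq_pexp2l ?leq_b1 ?prime_gt0.
Qed.

(* Psi is injective, so the kernel of cls \o Psi, which consists of the y with
   Psi y constant, embeds in Z/m through y |-> Psi y v0: it is cyclic. *)
Lemma embeds_truncation (V : finType) (e : rel V) k m r d
    (Psi : {additive direct_sum d r -> {ffun V -> Zmod m}}) (v0 : V) :
  regular e k ->
  (forall i, (1 <= i <= r)%N -> (0 < d i)%N) ->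
  (forall i, (1 <= i < r)%N -> (1 < d i)%N) ->
  (forall i, (1 <= i < r)%N -> (d i %| d i.+1)%N) ->
  injective Psi -> (forall y, cls (Psi y) \in ker_Abar e m) ->
  embeds (direct_sum d r.-1) (ker_Abar e m).
Proof.
move=> reg d0 d1 chain_d inj_Psi Psi_ker.
(* [h y] is the representative of the class of [Psi y] that vanishes at [v0]; it is zero exactly
   when [Psi y] is constant. *)
have [h hE] : exists h : {additive direct_sum d r -> {ffun V -> Zmod m}},
    h =1 fun y => Psi y - [ffun=> Psi y v0].
  apply: additive_of_morph => y y'; apply/ffunP => v.
  by rewrite raddfD !ffunE opprD addrACA.
have cls_h y : cls (h y) = cls (Psi y).
  apply/eqP; rewrite hE cls_eqE; apply/(const_vecP _ v0) => v.
  by rewrite !ffunE !(addrC (Psi y _)) !addrK.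
have h0 y : h y v0 = 0 by rewrite hE !ffunE subrr.
have ker_h p : prime p ->
    (#|[set x : direct_sum d r | (h x == 0%R) && (x *+ p == 0%R)]| <= p)%N.
  move=> pr_p; apply: leq_trans (card_torsion_Zp m.-1 pr_p).
  have inj_ev : {in [set x | (h x == 0%R) && (x *+ p == 0%R)] &,
      injective (fun x => Psi x v0)}.
    have PsiE x : h x = 0 -> Psi x = [ffun=> Psi x v0].
      by rewrite hE => /eqP; rewrite subr_eq0 => /eqP.
    move=> x y; rewrite !inE => /andP[/eqP/PsiE Px _] /andP[/eqP/PsiE Py _] eq_xy.
    by apply: inj_Psi; rewrite Px Py eq_xy.
  rewrite -(card_in_imset inj_ev); apply: subset_leq_card.
  apply/subsetP => _ /imsetP[x xK ->]; move: xK; rewrite !inE => /andP[_ /eqP px].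
  by rewrite -ffunMnE -raddfMn px raddf0 ffunE.
have [g [inj_g gE]] := embed_of_small_kernel d0 d1 chain_d ker_h.
have [phi phiE] : exists phi : {additive direct_sum d r.-1 -> vec_quot V m},
    phi =1 @cls V m \o g.
  by apply: additive_of_morph => x y /=; rewrite !raddfD.
exists phi; split=> [|x]; last first.
  by rewrite phiE /=; have [y ->] := gE x; rewrite cls_h.
apply: raddf_inj => x; rewrite phiE /= => /eqP; rewrite cls_eq0.
(* [g x] is some [h y], so it vanishes at [v0]; being constant, it is zero. *)
move/(const_vecP _ v0) => g_c; apply: inj_g; rewrite raddf0; apply/ffunP => v.
by rewrite g_c ffunE; have [y ->] := gE x.
Qed.

Theorem theorem1p2
    (V : finType) (e : rel V) (V_nonempty : (0 < #|V|)%N)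
    (e_simple : simple_graph e) (k : nat) (e_regular : regular e k)
    (Gamma : finZmodType) (r : nat) (d : nat -> nat)
    (Gamma_decomp : invariant_factor_decomposition Gamma r d) :
  [/\ d r = exponent [set: Gamma],
      (exists f : V -> Gamma, magic e f /\ generating f) <->
        embeds (direct_sum d r.-1) (ker_Abar e (d r)),
      (exists f : V -> Gamma, magic e f /\ affinely_generating f) <->
        embeds Gamma (ker_Abar e (d r))
    & #|V| = #|Gamma| ->
        ((exists f : V -> Gamma, distance_magic_labeling e f) <->
         (exists phi : {additive Gamma -> vec_quot V (d r)},
            is_embedding (ker_Abar e (d r)) phi /\
            vertex_separating [in codom phi]))].
Proof.
have [v0 _] := card_gt0P V_nonempty.
case: Gamma_decomp; case: r => // r _ chain_d d_gt1 isoG.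
have d0 i : (1 <= i <= r.+1)%N -> (0 < d i)%N.
  case: d_gt1 => [d_gt1 /d_gt1/ltnW // | [[->] d1] /andP[i1 i2]].
  by have/eqP-> : i == 1%N; rewrite ?d1 // eqn_leq i1 i2.
have d1 i : (1 <= i < r.+1)%N -> (1 < d i)%N.
  case: d_gt1 => [d_gt1 /andP[i1 lt_i] | [[->] _] /andP[i1 i2]].
    by rewrite d_gt1 // i1 ltnW.
  by move: (leq_ltn_trans i1 i2).
have dm (i : 'I_r.+1) : (0 < d i.+1)%N && (d i.+1 %| d r.+1)%N.
  by rewrite d0 ?(chain_dvdn chain_d) //= ltn_ord leqnn.
have expE := exponent_decomposition d0 chain_d isoG.
set m := d r.+1 in dm expE *.
have m0 : (0 < m)%N by apply: d0; rewrite leqnn.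
have exp_m : (exponent [set: Gamma] %| m)%N by rewrite -expE.
have [to_Psi of_Psi] := labeling_duality v0 e_regular m0
  exp_m dm isoG.
have [s [sK s0]] := cls_section m v0.
have [phi /additive_bij_inv[psi [phiK psiK]]] := isoG.
have lift_emb (g : {additive Gamma -> vec_quot V m}) :
    exists2 Psi : {additive Gamma -> {ffun V -> Zmod m}}, Psi =1 s \o g
      & forall y, cls (Psi y) = g y.
  have [Psi PsiE] : exists Psi : {additive Gamma -> {ffun V -> Zmod m}}, Psi =1 s \o g.
    by apply: additive_of_morph => x y /=; rewrite !raddfD.
  by exists Psi => // y; rewrite PsiE /= sK.
have cls_hom (Psi : {additive Gamma -> {ffun V -> Zmod m}}) :
    exists g : {additive Gamma -> vec_quot V m}, g =1 @cls V m \o Psi.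
  by apply: additive_of_morph => x y /=; rewrite !raddfD.
split=> //.
- split=> [[f [f_magic f_gen]] | [g [inj_g g_ker]]].
    have [Psi [Psi_magic Psi_gen _ _]] := to_Psi f.
    have [Psi' Psi'E] : exists Psi' : {additive direct_sum d r.+1 -> {ffun V -> Zmod m}},
        Psi' =1 Psi \o psi.
      by apply: additive_of_morph => x y /=; rewrite !raddfD.
    apply: (@embeds_truncation _ _ _ _ r.+1 d Psi' v0) => // [x y|y].
      by rewrite !Psi'E => /(Psi_gen.1 f_gen)/(can_inj psiK).
    by rewrite Psi'E; apply: Psi_magic.1.
  pose trunc (x : direct_sum d r.+1) : direct_sum d r :=
    [ffun i : 'I_r => (x (widen_ord (leqnSn r) i) : Zmod (d i.+1))].
  have truncD : {morph trunc : x y / x + y}.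
    by move=> x y; apply: dsumP => i; rewrite dsumD !ffunE ?dsumD.
  (* The first [r] coordinates go through the given embedding, normalised at [v0], and the last one,
     which lies in Z/m, becomes a constant vector. Evaluation at [v0] thus returns the last
     coordinate. *)
  have [Psi PsiE] : exists Psi : {additive Gamma -> {ffun V -> Zmod m}},
      Psi =1 fun y => s (g (trunc (phi y))) + [ffun=> (phi y ord_max : Zmod m)].
    apply: additive_of_morph => x y; rewrite raddfD truncD !raddfD addrACA.
    by congr (_ + _); apply/ffunP => v; rewrite !ffunE ?dsumD.
  have cls_Psi y : cls (Psi y) = g (trunc (phi y)).
    rewrite -[RHS]sK; apply/eqP; rewrite cls_eqE; apply/(const_vecP _ v0) => v.
    by rewrite PsiE !ffunE !(addrC (s _ _)) !addrK.
  have [f [f_magic f_gen _ _]] := of_Psi Psi; exists f; split.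
    by apply/f_magic => y; rewrite cls_Psi.
  apply/f_gen; apply: raddf_inj => y Psi0; apply: (can_inj phiK); rewrite raddf0.
  have last0 : phi y ord_max = 0.
    by move/ffunP/(_ v0): Psi0; rewrite PsiE !ffunE s0 add0r.
  have trunc0 : trunc (phi y) = 0.
    by apply: inj_g; rewrite raddf0 -cls_Psi Psi0 raddf0.
  apply: dsumP => i; rewrite dsum0; case: (ltnP i r) => [lt_ir | le_ri].
    have -> : i = widen_ord (leqnSn r) (Ordinal lt_ir) by apply: val_inj.
    by move/(congr1 (fun x : direct_sum d r => x (Ordinal lt_ir))): trunc0; rewrite ffunE dsum0.
  have -> // : i = ord_max.
  by apply: val_inj; apply/eqP; rewrite eqn_leq le_ri -ltnS ltn_ord.
- split=> [[f [f_magic f_gen]] | [g [inj_g g_ker]]].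
    have [Psi [Psi_magic _ Psi_gen _]] := to_Psi f.
    have [g gE] := cls_hom Psi; exists g; split=> [|y]; last by rewrite gE; apply: Psi_magic.1.
    by apply: eq_inj (Psi_gen.1 f_gen) _ => y; rewrite gE.
  have [Psi _ PsiE] := lift_emb g; have [f [f_magic _ f_gen _]] := of_Psi Psi.
  exists f; split; first by apply/f_magic => y; rewrite PsiE.
  by apply/f_gen; apply: eq_inj inj_g _ => y; rewrite /= PsiE.
move=> card_V; split=> [[f [f_magic f_bij]] | [g [[inj_g g_ker] g_sep]]].
  have [Psi [Psi_magic _ Psi_gen Psi_sep]] := to_Psi f.
  have f_gen : affinely_generating f.
    apply/eqP; rewrite eqEsubset subsetT; apply/subsetP => x _; apply/mem_gen.
    have [f' fK f'K] := f_bij.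
    by apply/imset2P; exists (f' x) (f' 0); rewrite ?f'K ?subr0.
  have [g gE] := cls_hom Psi; exists g; split; first split=> [|y].
  - by apply: eq_inj (Psi_gen.1 f_gen) _ => y; rewrite gE.
  - by rewrite gE; apply: Psi_magic.1.
  move=> v w neq_vw.
  have [y neq_y] : exists y, Psi y v != Psi y w.
    apply/existsP; apply: contraT; rewrite negb_exists => /forallP eq_y.
    case/eqP: neq_vw; apply: (bij_inj f_bij); apply/Psi_sep => y.
    by apply/eqP; move: (eq_y y); rewrite negbK.
  exists (Psi y); rewrite subr_eq0; split=> //.
  by rewrite -[cls _]gE; apply: codom_f.
have [Psi _ PsiE] := lift_emb g; have [f [f_magic _ _ f_sep]] := of_Psi Psi.
exists f; split; first by apply/f_magic => y; rewrite PsiE.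
apply: inj_card_bij; last by rewrite card_V.
(* A separating [x] has the class of some [Psi y], so [x - Psi y] is constant; [f v = f w] makes
   [Psi y] agree at [v] and [w], hence [x] too. *)
move=> v w eq_f; apply/eqP; apply: contraT => /g_sep[x [/codomP[y xE] neq_x]].
move: xE => /eqP; rewrite -PsiE cls_eqE => /(const_vecP _ w)/(_ v).
rewrite !ffunE ((f_sep v w).1 eq_f) => /addIr eq_x.
by rewrite eq_x subrr eqxx in neq_x.
Qed.
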